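(* Let $f \subseteq \mathcal{X} \times \mathcal{Y} \times \mathcal{Z}$ be a (complete) relation and $\epsilon > 0$. Then $$ \mathrm{rment}_{2\epsilon}(f) - 1 \leq \mathrm{R}^{1,\mathrm{pub}}_{\epsilon}(f) \leq \mathrm{crment}_{\epsilon/5,\epsilon/5}(f) + O\!\left(\log \tfrac{1}{\epsilon}\right). $$ Hence $$ \mathrm{R}^{1,\mathrm{pub}}_{\epsilon}(f) = \Theta(\mathrm{rment}_{\epsilon}(f)) = \Theta(\mathrm{crment}_{\epsilon,\epsilon}(f)). $$
   Context: $\mathcal{X},\mathcal{Y},\mathcal{Z}$ are finite sets. The relation $f$ is complete, i.e. for every $(x,y)$ there is some $z$ with $(x,y,z)\in f$. Logarithms are base $2$. For a distribution $\lambda$ on $\mathcal{X}\times\mathcal{Y}$ write $\lambda(x|y)=\lambda(x,y)/\lambda(y)$ and $\lambda(y|x)=\lambda(x,y)/\lambda(x)$. A one-way protocol for $f$: Alice, holding $x$, sends a single message to Bob, holding $y$. Bob outputs $z$, and the protocol is correct on $(x,y)$ if $(x,y,z)\in f$. The communication is the message length in bits. $\mathrm{R}^{1,\mathrm{pub}}_{\epsilon}(f)$ is the minimum communication of a public-coin one-way protocol for $f$ that errs with probability at most $\epsilon$ on every input $(x,y)$. A distribution $\lambda$ on $\mathcal{X}\times\mathcal{Y}$ is one-way for a distribution $\mu$ if $\mu(y|x)=\lambda(y|x)$ for all $(x,y)$ in the support of $\lambda$. $\mathrm{err}_f(\lambda)=\min_{g:\mathcal{Y}\to\mathcal{Z}}\Pr_{(x,y)\leftarrow\lambda}[(x,y,g(y))\notin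 f]$. $S_\infty(\lambda\|\mu)=\max_{(x,y)}\log\frac{\lambda(x,y)}{\mu(x,y)}$, the relative min-entropy. $\mathrm{crment}^{\mu}_{\delta}(\lambda)$ is the minimum $c$ with $\Pr_{(x,y)\leftarrow\lambda}[\log\frac{\lambda(x|y)}{\mu(x|y)}>c]\le\delta$. $\mathrm{crment}^{\mu}_{\epsilon,\delta}(f)=\min\{\mathrm{crment}^{\mu}_{\delta}(\lambda): \lambda \text{ one-way for }\mu,\ \mathrm{err}_f(\lambda)\le\epsilon\}$, and $\mathrm{crment}_{\epsilon,\delta}(f)=\max_\mu \mathrm{crment}^{\mu}_{\epsilon,\delta}(f)$. $\mathrm{rment}^{\mu}_{\epsilon}(f)=\min\{S_\infty(\lambda\|\mu): \lambda \text{ one-way for }\mu,\ \mathrm{err}_f(\lambda)\le\epsilon\}$, and $\mathrm{rment}_{\epsilon}(f)=\max_\mu\mathrm{rment}^{\mu}_{\epsilon}(f)$. All maxima are over distributions $\mu$ on $\mathcal{X}\times\mathcal{Y}$.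
   Formalization: The same-ε Θ claims fail for relations; they are proved with ε changed to ε/k (k absolute) on the bounding side and an added O(log 1/ε) term. O(log 1/ε) means O(max(1, log 1/ε)); the upper bound is for ε < 5, the Θ claims for ε < 1; X and Y are non-empty. *)

(* Defs.v *)
From mathcomp Require Import all_boot all_order all_algebra.
From mathcomp Require Import all_classical all_reals.
From mathcomp Require Import ereal exp.

Set Implicit Arguments.
Unset Strict Implicit.
Unset Printing Implicit Defensive.

Import Order.TTheory GRing.Theory Num.Theory.

Local Open Scope ring_scope.

Definition log2 (R : realType) (x : R) : R := ln x / ln 2.

(* log (p / q) for p, q >= 0, with log (0 / q) = -oo (also when q = 0) and
   log (p / 0) = +oo when p > 0. *)
Definition log_ratio (R : realType) (p q : R) : \bar R :=
  if p == 0 then -oo%E else if q == 0 then +oo%E else (log2 (p / q))%:E.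

Definition is_dist (R : realType) (T : finType) (p : {ffun T -> R}) : Prop :=
  (forall t, 0 <= p t) /\ \sum_t p t = 1.

Definition Pr (R : realType) (T : finType) (p : {ffun T -> R}) (E : pred T) : R :=
  \sum_(t | E t) p t.

Definition complete_rel (X Y Z : finType) (f : {set X * Y * Z}) : Prop :=
  forall x y, exists z, (x, y, z) \in f.

Section Distributions.
Variables (R : realType) (X Y : finType).
Implicit Types (l m : {ffun X * Y -> R}).

Definition margX l (x : X) : R := \sum_y l (x, y).
Definition margY l (y : Y) : R := \sum_x l (x, y).

(* When the conditioning event has probability 0 these are 0. *)
Definition cond_XY l (x : X) (y : Y) : R := l (x, y) / margY l y.
Definition cond_YX l (y : Y) (x : X) : R := l (x, y) / margX l x.

(* Since x / 0 = 0, the equation fails when l (x, y) > 0 and m gives x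
   probability 0: there m (y | x) is undefined. *)
Definition one_way l m : Prop :=
  forall x y, 0 < l (x, y) -> cond_YX m y x = cond_YX l y x.

(* S_oo (l || m) *)
Definition rel_min_entropy l m : \bar R :=
  \big[Order.max/-oo%E]_(a : X * Y) log_ratio (l a) (m a).

(* crment^m_delta (l) *)
Definition crment_dist (m : {ffun X * Y -> R}) (delta : R) l : \bar R :=
  ereal_inf [set c%:E | c in [set c : R |
    Pr l (fun a => (c%:E < log_ratio (cond_XY l a.1 a.2)
                                     (cond_XY m a.1 a.2))%E) <= delta]].

End Distributions.

Section Bounds.
Variables (R : realType) (X Y Z : finType) (f : {set X * Y * Z}).
Implicit Types (l m : {ffun X * Y -> R}).

(* The default value 1 of the minimum is harmless: error probabilities are at
   most 1, and there is some g as soon as Z is inhabited. *)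
Definition err l : R :=
  \big[Num.min/1]_(g : {ffun Y -> Z})
    Pr l (fun a => (a.1, a.2, g a.2) \notin f).

Definition feasible m (eps : R) l : Prop :=
  [/\ is_dist l, one_way l m & err l <= eps].

Definition rment_at m (eps : R) : \bar R :=
  ereal_inf [set rel_min_entropy l m | l in [set l | feasible m eps l]].

Definition crment_at m (eps delta : R) : \bar R :=
  ereal_inf [set crment_dist m delta l | l in [set l | feasible m eps l]].

Definition rment (eps : R) : \bar R :=
  ereal_sup [set rment_at m eps | m in [set m | is_dist m]].

Definition crment (eps delta : R) : \bar R :=
  ereal_sup [set crment_at m eps delta | m in [set m | is_dist m]].

(* A public-coin one-way protocol with c-bit messages: shared coins w drawn
   from rho, message msg w x, output out w (msg w x) y. *)
Definition has_pub_protocol (eps : R) (c : nat) : Prop :=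
  exists (W : finType) (rho : {ffun W -> R})
         (msg : W -> X -> c.-tuple bool) (out : W -> c.-tuple bool -> Y -> Z),
    is_dist rho /\
    forall x y, Pr rho (fun w => (x, y, out w (msg w x) y) \notin f) <= eps.

(* R^{1,pub}_eps (f) *)
Definition R1pub (eps : R) : \bar R :=
  ereal_inf [set (c%:R)%:E | c in [set c : nat | has_pub_protocol eps c]].

End Bounds.

(* The function of eps inside O(log (1 / eps)): it equals log (1 / eps) for
   eps <= 1/2 and is 1 above, where log (1 / eps) tends to 0 and becomes
   negative. *)
Definition log_inv (R : realType) (eps : R) : R := Num.max 1 (log2 (1 / eps)).

(* A quantity attached to a relation f and an error parameter eps. *)
Definition rel_quantity (R : realType) : Type :=
  R -> forall X Y Z : finType, {set X * Y * Z} -> \bar R.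

(* O and Theta for such quantities, with constants that do not depend on f.
   The error parameter may change by a constant factor k and, for fixed eps,
   lower-order additive constants are allowed. Neither can be dropped: the
   error of a protocol for a relation cannot in general be reduced, and some
   relations have bounded R1pub at error eps but arbitrarily large rment at the
   same error eps (not at error 2 * eps). *)
Definition bigO_err (R : realType) (G H : rel_quantity R) : Prop :=
  exists k A : R, [/\ 1 <= k, 0 < A &
    forall (eps : R) (X Y Z : finType) (f : {set X * Y * Z}),
      0 < eps -> eps < 1 -> (0 < #|X|)%N -> (0 < #|Y|)%N -> complete_rel f ->
      (G eps X Y Z f <= A%:E * (H (eps / k)%R X Y Z f + (log_inv eps)%:E))%E].

Definition bigTheta_err (R : realType) (G H : rel_quantity R) : Prop :=
  bigO_err G H /\ bigO_err H G.

(* Main.v *)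
(* Lower bound: fixing the coins of a c-bit protocol, some message has
   probability at least 2^-(c+1) and conditional error at most 2 eps;
   conditioning mu on that message gives a distribution one-way for mu.

   Upper bound: a distribution one-way for mu is mu reweighted by a function of
   x. Peeling off such distributions greedily splits mu into parts (P_i, g_i),
   where Alice picks i with probability P_i(x) and Bob answers g_i(y). The bound
   on crment says that P_i(x) is typically at most 2^c / tau times Bob's
   estimate E[P_i | y] of it, so correlated sampling with a hash of
   c + O(log(1/eps)) bits lets Bob find i. A multiplicative-weights argument
   then turns distributional protocols into a public-coin one. *)

Require Import Defs.
From mathcomp Require Import all_boot all_order all_algebra.
From mathcomp Require Import all_classical all_reals.
From mathcomp Require Import ereal exp.
From mathcomp Require Import ring lra.

Set Implicit Arguments.
Unset Strict Implicit.
Unset Printing Implicit Defensive.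

Import Order.TTheory GRing.Theory Num.Theory.

Local Open Scope ring_scope.

(** * Finite probability tools and multiplicative weights *)

Lemma exists_le_average (R : realType) (W : finType) (rho : {ffun W -> R})
    (F : W -> R) (d : R) :
  is_dist rho -> \sum_w rho w * F w <= d -> exists w, F w <= d.
Proof.
move=> [rho_ge0 rho1] avg; apply: contrapT => nF.
have F_gt w : d < F w by rewrite ltNge; apply/negP => Fd; apply: nF; exists w.
have rho0 : \sum_w rho w * (F w - d) == 0.
  rewrite eq_le; apply/andP; split.
    under eq_bigr do rewrite mulrBr.
    by rewrite sumrB -mulr_suml rho1 mul1r subr_le0.
  by apply: sumr_ge0 => w _; rewrite mulr_ge0// subr_ge0 ltW.
move: rho0; rewrite psumr_eq0; last first.
  by move=> w _; rewrite mulr_ge0// subr_ge0 ltW.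
move=> /allP rho0; move: rho1; rewrite big1 => [/eqP|w _].
  by rewrite eq_sym oner_eq0.
have /implyP/(_ isT) := rho0 w (mem_index_enum _).
by rewrite mulf_eq0 subr_eq0 (gt_eqF (F_gt w)) orbF => /eqP.
Qed.

Lemma le_Pr (R : realType) (T : finType) (p : {ffun T -> R}) (E F : pred T) :
  is_dist p -> (forall t, 0 < p t -> E t -> F t) -> Pr p E <= Pr p F.
Proof.
move=> [p0 _] EF; rewrite /Pr [leLHS]big_mkcond [leRHS]big_mkcond /=.
apply: ler_sum => t _; move: (p0 t) (EF t); rewrite le_eqVlt => /predU1P[<-|pt].
  by move=> _; case: ifP; case: ifP.
by move=> /(_ pt); case: (E t) => [->//|_]; case: (F t) => //; exact: ltW.
Qed.

Lemma Pr_le1 (R : realType) (T : finType) (p : {ffun T -> R}) (E : pred T) :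
  is_dist p -> Pr p E <= 1.
Proof.
by move=> dp; case: (dp) => _ <-; exact: (@le_Pr _ _ p E xpredT).
Qed.

(* A uniform u in [0, 1] with the test u <= v, discretised at the points of s. *)
Lemma threshold_coupling (R : realType) (s : seq R) :
  all (fun v => 0 <= v <= 1) s ->
  exists (U : finType) (nu : {ffun U -> R}) (acc : U -> R -> bool),
    [/\ is_dist nu,
        forall u v v', v <= v' -> acc u v -> acc u v' &
        forall v, v \in s -> Pr nu (acc ^~ v) = v].
Proof.
move=> s01; pose t := sort <=%R (0 :: 1 :: s).
have t_le i j : (i <= j < size t)%N -> t`_i <= t`_j.
  move=> /andP[ij jt].
  by apply: (sorted_leq_nth le_trans lexx) => //; rewrite ?inE ?(leq_ltn_trans ij)//;
    apply: sort_le_sorted.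
have mem_t x : (x \in t) = (x \in 0 :: 1 :: s) by rewrite mem_sort.
have t01 x : x \in t -> 0 <= x <= 1.
  rewrite mem_t !inE => /or3P[/eqP->|/eqP->|xs]; rewrite ?lexx ?ler01//.
  exact: (allP s01).
have size_t : size t = (size s).+2 by rewrite size_sort.
have tle i : t`_i <= 1.
  have [it|it] := ltnP i (size t); first by have /andP[] := t01 _ (mem_nth 0 it).
  by rewrite nth_default ?ler01.
have t0 : t`_0 = 0.
  apply/eqP; rewrite eq_le; apply/andP; split; last first.
    by have /andP[] : 0 <= t`_0 <= 1 by apply/t01/mem_nth; rewrite size_t.
  have m0 : 0 \in t by rewrite mem_t inE eqxx.
  by rewrite -[leRHS](nth_index 0 m0); apply: t_le; rewrite /= index_mem.
have t1 : t`_(size s).+1 = 1.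
  apply/eqP; rewrite eq_le tle /=.
  have m1 : 1 \in t by rewrite mem_t !inE eqxx orbT.
  rewrite -[leLHS](nth_index 0 m1); apply: t_le.
  by rewrite [in X in _ && X]size_t ltnSn andbT -ltnS -size_t index_mem.
(* An outcome is a gap between consecutive sorted points, weighted by its length; it accepts [v]
   when the whole gap lies below [v]. *)
exists 'I_(size s).+1, [ffun i : 'I__ => t`_i.+1 - t`_i], (fun i v => t`_(i : 'I__).+1 <= v).
have tele (F : nat -> R) :
      \sum_(i < (size s).+1) (F i.+1 - F i) = F (size s).+1 - F 0%N.
  rewrite -(big_mkord xpredT (fun i => F i.+1 - F i)); exact: telescope_sumr.
split.
- split=> [i|]; last first.
    under eq_bigr do rewrite ffunE.
    by rewrite (tele (fun i => t`_i)) t0 t1 subr0.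
  by rewrite ffunE subr_ge0 t_le// leqnSn /= size_t ltnS.
- by move=> u v v' vv' /le_trans; apply.
- move=> v vs; have vt : v \in t by rewrite mem_t !inE vs !orbT.
  have /andP[v0 v1] := t01 _ vt.
  (* No sorted point lies strictly between [v] and itself in the list, so each gap is entirely kept
     or entirely cut by truncation at [v]; the truncated sum telescopes to [v]. *)
  transitivity (\sum_(i < (size s).+1) (Num.min t`_i.+1 v - Num.min t`_i v)).
    rewrite /Pr big_mkcond /=; apply: eq_bigr => i _; rewrite ffunE.
    have it : t`_i <= t`_i.+1 by apply: t_le; rewrite leqnSn /= size_t ltnS.
    case: ifPn => [tv|]; first by rewrite !min_l// (le_trans it).
    rewrite -ltNge => vti.
    have vi : v <= t`_i.
      have tm := nth_index 0 vt.
      have le_i : (index v t <= i)%N.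
        rewrite leqNgt; apply/negP => im; move: vti; rewrite ltNge => /negP[].
        by rewrite -[leRHS]tm; apply: t_le; rewrite im index_mem.
      rewrite -[leLHS]tm; apply: t_le.
      by rewrite le_i size_t ltnS ltnW.
    by rewrite !min_r ?subrr// ltW.
  by rewrite (tele (fun i => Num.min t`_i v)) t0 t1 min_r// min_l// subr0.
Qed.

(** Each point carries a weight that doubles whenever a chosen strategy errs on it. A strategy that
    is good against the normalised weights raises their total by a factor of at most [1 + d]. The
    weights stay positive, so only distributions of full support are ever played against. *)
Lemma multiplicative_weights (R : realType) (S : Type) (A : finType)
    (loss : S -> A -> bool) (d : R) (T : nat) :
  (0 < #|A|)%N ->
  (forall m : {ffun A -> R}, is_dist m -> (forall a, 0 < m a) ->
    exists s, Pr m (loss s) <= d) ->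
  exists s : 'I_T -> S,
    \sum_a 2 ^+ (\sum_(t < T) loss (s t) a)%N <= #|A|%:R * (1 + d) ^+ T.
Proof.
move=> A_gt0 good.
suff [s [sT le_s]] : exists s : seq S, size s = T /\
    \sum_a 2 ^+ (\sum_(t <- s) loss t a)%N <= #|A|%:R * (1 + d) ^+ T.
  subst T; exists (tnth (in_tuple s)).
  by under eq_bigr do rewrite -(big_tnth _ _ s xpredT (fun t => nat_of_bool (loss t _))).
elim: T => [|T [s [sT le_s]]].
  exists [::]; split=> //.
  by under eq_bigr do rewrite big_nil expr0; rewrite mulr1 sumr_const.
pose w a : R := 2 ^+ (\sum_(t <- s) loss t a)%N.
have w_gt0 a : 0 < w a by rewrite exprn_gt0.
pose tot := \sum_a w a.
have tot_gt0 : 0 < tot.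
  have /card_gt0P[a _] := A_gt0.
  by rewrite /tot (bigD1 a)//= ltr_pwDl// sumr_ge0// => i _; exact: ltW.
have [||t tP] := good [ffun a => w a / tot].
- split=> [a|]; first by rewrite ffunE divr_ge0 ?ltW.
  by under eq_bigr do rewrite ffunE; rewrite -mulr_suml mulfV ?gt_eqF.
- by move=> a; rewrite ffunE divr_gt0.
exists (t :: s); split; first by rewrite /= sT.
have -> : \sum_a (2 ^+ (\sum_(t0 <- t :: s) loss t0 a)%N : R) =
    tot * (1 + Pr [ffun a => w a / tot] (loss t)).
  rewrite mulrDr mulr1 /Pr mulr_sumr [in RHS]big_mkcond -big_split /=.
  apply: eq_bigr => a _; rewrite big_cons exprD -/(w a) ffunE.
  case: (loss t a); rewrite ?expr0 ?expr1; last by rewrite mul1r addr0.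
  by rewrite mulrCA mulfV ?gt_eqF// mulr1 mulr_natl mulr2n.
have Pt0 : 0 <= Pr [ffun a => w a / tot] (loss t).
  by apply: sumr_ge0 => a _; rewrite ffunE divr_ge0 ?ltW.
rewrite exprS mulrCA [leRHS]mulrC; apply: ler_pM => //.
- exact: ltW.
- by rewrite addr_ge0.
- by rewrite lerD2l.
Qed.

Definition unif (R : realType) (T : finType) : {ffun T -> R} :=
  [ffun=> #|T|%:R^-1].

Definition prod_dist (R : realType) (S T : finType) (p : {ffun S -> R})
    (q : {ffun T -> R}) : {ffun S * T -> R} :=
  [ffun a => p a.1 * q a.2].

Lemma PrE (R : realType) (T : finType) (p : {ffun T -> R}) (E : pred T) :
  Pr p E = \sum_t p t * (E t)%:R.
Proof.
rewrite /Pr big_mkcond; apply: eq_bigr => t _.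
by case: (E t); rewrite ?mulr1 ?mulr0.
Qed.

Lemma Pr_ge0 (R : realType) (T : finType) (p : {ffun T -> R}) (E : pred T) :
  is_dist p -> 0 <= Pr p E.
Proof. by move=> [p0 _]; apply: sumr_ge0 => t _. Qed.

Lemma is_dist_unif (R : realType) (T : finType) :
  (0 < #|T|)%N -> is_dist (unif R T).
Proof.
move=> T0; split=> [t|]; first by rewrite ffunE invr_ge0.
under eq_bigr do rewrite ffunE.
by rewrite sumr_const -[LHS]mulr_natr mulVf// pnatr_eq0 -lt0n.
Qed.

Lemma Pr_unif1 (R : realType) (T : finType) (a : T) :
  Pr (unif R T) (fun t => t == a) = #|T|%:R^-1.
Proof. by rewrite /Pr big_pred1_eq ffunE. Qed.

Lemma Pr_prod (R : realType) (S T : finType) (p : {ffun S -> R})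
    (q : {ffun T -> R}) (E : pred (S * T)) :
  Pr (prod_dist p q) E = \sum_s p s * Pr q (fun t => E (s, t)).
Proof.
rewrite PrE; under [RHS]eq_bigr do rewrite PrE mulr_sumr.
rewrite pair_big /=; apply: eq_bigr => -[s t] _.
by rewrite ffunE mulrA.
Qed.

Lemma is_dist_prod (R : realType) (S T : finType) (p : {ffun S -> R})
    (q : {ffun T -> R}) :
  is_dist p -> is_dist q -> is_dist (prod_dist p q).
Proof.
move=> [p0 p1] [q0 q1]; split=> [a|]; first by rewrite ffunE mulr_ge0.
have := Pr_prod p q xpredT; rewrite /Pr /= => ->.
by under eq_bigr do rewrite q1 mulr1.
Qed.

Lemma Pr_prodl (R : realType) (S T : finType) (p : {ffun S -> R})
    (q : {ffun T -> R}) (E : pred S) :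
  is_dist q -> Pr (prod_dist p q) (fun a => E a.1) = Pr p E.
Proof.
move=> [_ q1]; rewrite Pr_prod PrE; apply: eq_bigr => s _ /=; congr (_ * _).
by rewrite /Pr; case: (E s) => //; rewrite big_pred0.
Qed.

Lemma Pr_orb_le (R : realType) (T : finType) (p : {ffun T -> R}) (E F : pred T) :
  is_dist p -> Pr p (fun t => E t || F t) <= Pr p E + Pr p F.
Proof.
move=> [p0 _]; rewrite !PrE -big_split /=; apply: ler_sum => t _.
rewrite -mulrDr; apply: ler_wpM2l => //; rewrite -natrD ler_nat.
by case: (E t); case: (F t).
Qed.

(** * Protocols built from rounds, and correlated sampling *)

(** The error bound may depend on the input, so that bounds can be composed round by round and
    averaged over a distribution only at the end. *)
Definition has_protocol (R : realType) (X Y Z : finType) (f : {set X * Y * Z})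
    (k : nat) (e : X -> Y -> R) : Prop :=
  exists (W : finType) (rho : {ffun W -> R})
         (msg : W -> X -> k.-tuple bool) (out : W -> k.-tuple bool -> Y -> Z),
    is_dist rho /\
    forall x y, Pr rho (fun w => (x, y, out w (msg w x) y) \notin f) <= e x y.

Lemma has_protocol_le (R : realType) (X Y Z : finType) (f : {set X * Y * Z})
    (k : nat) (e e' : X -> Y -> R) :
  (forall x y, e x y <= e' x y) -> has_protocol f k e -> has_protocol f k e'.
Proof.
move=> ee' [W [rho [msg [out [d le_e]]]]]; exists W, rho, msg, out; split=> //.
by move=> x y; apply: le_trans (ee' x y).
Qed.

Lemma constant_protocol (R : realType) (X Y Z : finType) (f : {set X * Y * Z})
    (k : nat) (z : Z) :
  has_protocol f k (fun _ _ => 1 : R).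
Proof.
exists unit, (unif R unit), (fun _ _ => [tuple of nseq k false]), (fun _ _ _ => z).
have d : is_dist (unif R unit) by apply: is_dist_unif; rewrite card_unit.
by split=> // x y; exact: Pr_le1.
Qed.

(* In a round Alice may commit to the sample s by sending its hash h; Bob uses
   the first round that he accepts and whose hash matches the message. *)
Lemma add_round (R : realType) (X Y Z S : finType) (f : {set X * Y * Z}) (k : nat)
    (e : X -> Y -> R) (sigma : {ffun S -> R})
    (A : S -> X -> bool) (B : S -> Y -> bool) (g : S -> Y -> Z) :
  is_dist sigma -> has_protocol f k e ->
  has_protocol f k (fun x y =>
    Pr sigma (fun s => A s x && ~~ (B s y && ((x, y, g s y) \in f)))
    + 2 ^- k * Pr sigma (B ^~ y) + (1 - Pr sigma (A ^~ x)) * e x y).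
Proof.
move=> ds [W [rho [msg [out [drho le_e]]]]].
pose H := k.-tuple bool.
have cardH : #|{: H}|%:R^-1 = 2 ^- k :> R by rewrite card_tuple card_bool natrX.
have dH : is_dist (unif R H).
  by apply: is_dist_unif; rewrite card_tuple card_bool expn_gt0.
have dWH := is_dist_prod drho dH.
exists (S * (W * H))%type, (prod_dist sigma (prod_dist rho (unif R H))).
exists (fun w x => if A w.1 x then w.2.2 else msg w.2.1 x).
exists (fun w m y => if B w.1 y && (w.2.2 == m) then g w.1 y else out w.2.1 m y).
split=> [|x y]; first by apply: is_dist_prod.
rewrite Pr_prod [1 - _](_ : _ = Pr sigma (fun s => ~~ A s x)); last first.
  case: ds => _ <-; rewrite !PrE -sumrB; apply: eq_bigr => s _.
  by case: (A s x); rewrite ?mulr1 ?mulr0 ?subrr ?subr0.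
rewrite !PrE mulr_sumr mulr_suml -!big_split /=; apply: ler_sum => s _.
rewrite [leRHS](_ : _ = sigma s * ((A s x && ~~ (B s y && ((x, y, g s y) \in f)))%:R
   + 2 ^- k * (B s y)%:R + (~~ A s x)%:R * e x y)); last by ring.
apply: ler_wpM2l; first by case: ds.
rewrite /=; have [Asx|nAsx] := boolP (A s x).
  rewrite mul0r addr0.
  have k0 : 0 <= 2 ^- k * (B s y)%:R :> R by rewrite mulr_ge0.
  case: (boolP (B s y)) => [Bsy|nBsy] /=; last first.
    by rewrite mulr0 addr0; exact: Pr_le1.
  case: (boolP ((x, y, g s y) \in f)) => [fxyz|nf] /=.
    rewrite add0r mulr1 /Pr big_pred0 ?invr_ge0 ?exprn_ge0// => t /=.
    by rewrite eqxx fxyz.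
  by apply: le_trans (Pr_le1 _ dWH) _; rewrite lerDl mulr1 invr_ge0 exprn_ge0.
(* Alice passes, so the message is that of the later rounds. It is independent of the fresh hash of
   this round, and thus misleads an accepting Bob with probability [2 ^- k]. *)
rewrite add0r mul1r.
have := le_e x y.
rewrite -(Pr_prodl rho (fun w => (x, y, out w (msg w x) y) \notin f) dH) => le1.
case: (boolP (B s y)) => /= Bsy; last by rewrite mulr0 add0r.
apply: le_trans (lerD _ le1).
  apply: le_trans (Pr_orb_le _ _ dWH).
  apply: (@le_Pr _ _ _ _
    (fun a => (a.2 == msg a.1 x) || ((x, y, out a.1 (msg a.1 x) y) \notin f))) => //.
  by move=> a _; case: eqP.
rewrite Pr_prod (eq_bigr (fun w => rho w * 2 ^- k)) => [|w _]; last first.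
  by rewrite -cardH -(Pr_unif1 R (msg w x)).
by rewrite -mulr_suml; case: drho => _ ->; rewrite mul1r mulr1.
Qed.

(** One more round turns an error [q] into at most [p + b + (1 - alpha) * q], where [p] is the
    failure of a round and [b] its hash collision. The geometric series sums to at most
    [(p + b) / alpha], and [(1 - alpha) ^+ T] covers the case that Alice never accepts. *)
Lemma repeat_rounds (R : realType) (X Y Z S : finType) (f : {set X * Y * Z})
    (k T : nat) (z : Z) (sigma : {ffun S -> R})
    (A : S -> X -> bool) (B : S -> Y -> bool) (g : S -> Y -> Z) (alpha beta : R) :
  is_dist sigma -> 0 < alpha <= 1 ->
  (forall x, Pr sigma (A ^~ x) = alpha) -> (forall y, Pr sigma (B ^~ y) <= beta) ->
  has_protocol f k (fun x y => (1 - alpha) ^+ T +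
    (Pr sigma (fun s => A s x && ~~ (B s y && ((x, y, g s y) \in f)))
     + beta / 2 ^+ k) / alpha).
Proof.
move=> ds /andP[a0 a1] PA PB; elim: T => [|T IH].
  apply: has_protocol_le (constant_protocol R f k z) => x y.
  rewrite expr0 lerDl divr_ge0 ?(ltW a0)// addr_ge0 ?Pr_ge0// divr_ge0 ?exprn_ge0//.
  exact: le_trans (Pr_ge0 _ ds) (PB y).
apply: has_protocol_le (add_round A B g ds IH) => x y; rewrite PA.
set p := Pr _ _; set q := _ ^+ T.
have le2 : 2 ^- k * Pr sigma (B^~ y) <= beta / 2 ^+ k.
  by rewrite mulrC; apply: ler_wpM2r (PB y); rewrite invr_ge0 exprn_ge0.
rewrite exprS -/q; set b := beta / _.
rewrite [leRHS](_ : _ = p + b + (1 - alpha) * (q + (p + b) / alpha)).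
  by rewrite !lerD2r lerD2l.
by field; rewrite gt_eqF.
Qed.

(* A round is a uniform i together with a shared threshold u; Alice accepts if
   u <= P i x and Bob accepts if u <= b i y. *)
Lemma sampling_protocol (R : realType) (X Y Z I : finType) (f : {set X * Y * Z})
    (k T : nat) (z : Z) (P : I -> X -> R) (b : I -> Y -> R) (g : I -> Y -> Z) (B : R) :
  (forall i x, 0 <= P i x) -> (forall x, \sum_i P i x = 1) ->
  (forall i y, 0 <= b i y) -> (forall y, \sum_i b i y <= B) -> (0 < #|I|)%N ->
  has_protocol f k (fun x y => (1 - #|I|%:R^-1) ^+ T +
    \sum_(i | (b i y < P i x) || ((x, y, g i y) \notin f)) P i x + B / 2 ^+ k).
Proof.
move=> P0 P1 b0 bB I0.
(* Thresholds must lie in the unit interval. Capping at 1 costs nothing, since [P i x <= b i y]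
   still gives [P i x <= b' i y]. *)
pose b' i y := Num.min 1 (b i y).
pose s := [seq P a.1 a.2 | a <- enum {: I * X}] ++ [seq b' a.1 a.2 | a <- enum {: I * Y}].
have P_le1 i x : P i x <= 1.
  by rewrite -(P1 x) (bigD1 i)//= lerDl sumr_ge0.
have [|U [nu [acc [dnu acc_le Pr_acc]]]] := @threshold_coupling R s.
  apply/allP => v; rewrite mem_cat => /orP[] /mapP[[i a] _ ->] /=.
    by rewrite P0 P_le1.
  by rewrite /b' le_min ler01 b0 ge_min lexx.
have Pr_P i x : Pr nu (acc ^~ (P i x)) = P i x.
  by apply: Pr_acc; rewrite mem_cat; apply/orP; left;
    apply/mapP; exists (i, x); rewrite ?mem_enum.
have Pr_b i y : Pr nu (acc ^~ (b' i y)) = b' i y.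
  by apply: Pr_acc; rewrite mem_cat; apply/orP; right;
    apply/mapP; exists (i, y); rewrite ?mem_enum.
pose sigma := prod_dist (unif R I) nu.
have dsigma : is_dist sigma by apply: is_dist_prod => //; exact: is_dist_unif.
have cI : 0 < #|I|%:R^-1 :> R by rewrite invr_gt0 ltr0n.
(* As [P] sums to 1, Alice's acceptance probability is the same for all [x]. The factor [#|I|%:R^-1]
   reappears in the failure and collision terms and cancels on division by it. *)
have Pr_A x : Pr sigma (fun a => acc a.2 (P a.1 x)) = #|I|%:R^-1.
  rewrite Pr_prod (eq_bigr (fun i => #|I|%:R^-1 * P i x)) => [|i _].
    by rewrite -mulr_sumr P1 mulr1.
  by rewrite ffunE -[in RHS]Pr_P.
have Pr_B y : Pr sigma (fun a => acc a.2 (b' a.1 y)) <= #|I|%:R^-1 * B.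
  rewrite Pr_prod (eq_bigr (fun i => #|I|%:R^-1 * b' i y)) => [|i _].
    rewrite -mulr_sumr; apply: ler_wpM2l; first exact: ltW.
    apply: le_trans (bB y); apply: ler_sum => i _.
    by rewrite /b' ge_min lexx orbT.
  by rewrite ffunE -[in RHS]Pr_b.
have := @repeat_rounds R X Y Z _ f k T z sigma (fun a x => acc a.2 (P a.1 x))
  (fun a y => acc a.2 (b' a.1 y)) (fun a => g a.1) _ _ dsigma _ Pr_A Pr_B.
rewrite cI invf_le1 ?ltr0n// ler1n I0 => /(_ isT).
apply: has_protocol_le => x y; rewrite -addrA lerD2l.
rewrite mulrDl; apply: lerD; last first.
  by rewrite mulrAC [X in X / _ / _]mulrC mulfK ?gt_eqF.
rewrite ler_pdivrMr// mulrC Pr_prod mulr_sumr [leRHS]big_mkcond /=.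
apply: ler_sum => i _; rewrite ffunE.
have [bad|] := ifPn.
  apply: ler_wpM2l; first exact: ltW.
  rewrite -[leRHS]Pr_P; apply: le_Pr => // u _; by case/andP.
(* For a good [i] Alice's threshold is at most Bob's, so under the shared [u] her acceptance forces
   his. *)
rewrite negb_or negbK -leNgt => /andP[Pb fxyz].
rewrite /Pr big_pred0 ?mulr0// => u; apply/negP => /andP[accP].
rewrite fxyz andbT => /negP[]; apply: acc_le accP.
by rewrite /b' le_min P_le1.
Qed.

(** * Between distributional and public-coin protocols *)

(** The easy direction of Yao's principle: after exchanging the sums, some value of the coins does
    no worse than their average. *)
Lemma derandomize (R : realType) (X Y Z : finType) (f : {set X * Y * Z}) (k : nat)
    (e : X -> Y -> R) (m : {ffun X * Y -> R}) (d : R) :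
  has_protocol f k e -> is_dist m -> \sum_a m a * e a.1 a.2 <= d ->
  exists (msg : X -> k.-tuple bool) (out : k.-tuple bool -> Y -> Z),
    Pr m (fun a => (a.1, a.2, out (msg a.1) a.2) \notin f) <= d.
Proof.
move=> [W [rho [msg [out [drho le_e]]]]] [m0 m1] avg.
suff [w wP] : exists w, Pr m (fun a => (a.1, a.2, out w (msg w a.1) a.2) \notin f) <= d.
  by exists (msg w), (out w).
apply: (exists_le_average drho); apply: le_trans avg.
under eq_bigr do rewrite PrE mulr_sumr.
rewrite exchange_big /=; apply: ler_sum => -[x y] _ /=.
under eq_bigr do rewrite mulrCA.
by rewrite -mulr_sumr ler_wpM2l// -PrE.
Qed.

Lemma ln2_ge_half (R : realType) : 1 / 2 <= ln 2 :> R.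
Proof.
have : ln (2^-1) <= 2^-1 - 1 :> R.
  by have := @le_ln1Dx R (2^-1 - 1); rewrite [1 + _]addrC subrK; apply; lra.
by rewrite lnV ?posrE//; lra.
Qed.

(** The hard direction of Yao's principle: the shared coins pick uniformly one of [T] deterministic
    protocols produced by multiplicative weights. If [L] of them err on an input, then
    [2 ^+ L <= N * (1 + d) ^+ T]. With [1 / 2 <= ln 2] this gives [L <= 2 * ln N + 2 * d * T], and
    [T] is taken large enough to absorb [2 * ln N] into the gap [eps - 2 * d]. *)
Lemma pub_protocol_of_distributional (R : realType) (X Y Z : finType)
    (f : {set X * Y * Z}) (k : nat) (d eps : R) :
  (0 < #|X|)%N -> (0 < #|Y|)%N -> 0 <= d -> 2 * d < eps ->
  (forall m : {ffun X * Y -> R}, is_dist m -> (forall a, 0 < m a) ->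
    exists (msg : X -> k.-tuple bool) (out : k.-tuple bool -> Y -> Z),
      Pr m (fun a => (a.1, a.2, out (msg a.1) a.2) \notin f) <= d) ->
  has_pub_protocol f eps k.
Proof.
move=> X0 Y0 d0 d_eps good.
have cXY : (0 < #|{: X * Y}|)%N by rewrite card_prod muln_gt0 X0.
pose N : R := #|{: X * Y}|%:R.
have N1 : 1 <= N by rewrite ler1n.
pose T := (Num.truncn (2 * ln N / (eps - 2 * d))).+1.
have T_gt : 2 * ln N < T%:R * (eps - 2 * d).
  by rewrite -ltr_pdivrMr ?subr_gt0// truncnS_gt.
pose S := ((X -> k.-tuple bool) * (k.-tuple bool -> Y -> Z))%type.
have [|s sP] := @multiplicative_weights R S {: X * Y}
    (fun s a => (a.1, a.2, s.2 (s.1 a.1) a.2) \notin f) d T cXY _.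
  move=> m dm m0; have [msg [out P]] := good m dm m0.
  by exists (msg, out).
exists 'I_T, (unif R 'I_T), (fun t => (s t).1), (fun t => (s t).2).
split=> [|x y]; first by apply: is_dist_unif; rewrite card_ord.
pose L : nat := (\sum_(t < T) ((x, y, (s t).2 ((s t).1 x) y) \notin f))%N.
have -> : Pr (unif R 'I_T)
    (fun w => (x, y, (s w).2 ((s w).1 x) y) \notin f) = L%:R / T%:R.
  rewrite PrE natr_sum mulr_suml; apply: eq_bigr => t _.
  by rewrite ffunE card_ord mulrC.
rewrite ler_pdivrMr ?ltr0n//.
have : 2 ^+ L <= N * (1 + d) ^+ T.
  apply: le_trans sP; rewrite (bigD1 (x, y))//= lerDl.
  by apply: sumr_ge0 => a _; rewrite exprn_ge0.
have d1 : 0 < 1 + d by lra.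
have N0 : 0 < N by lra.
rewrite -ler_ln ?posrE ?exprn_gt0 ?mulr_gt0 ?exprn_gt0//.
rewrite lnM ?posrE ?exprn_gt0// !lnXn// => le_ln.
have ln_d : ln (1 + d) <= d by apply: le_ln1Dx; lra.
have le1 : ln 2 *+ L >= 2^-1 * L%:R :> R.
  rewrite -[ln 2 *+ L]mulr_natr; apply: ler_wpM2r => //.
  by have := ln2_ge_half R; lra.
have le2 : ln (1 + d) *+ T <= d * T%:R.
  by rewrite -[ln (1 + d) *+ T]mulr_natr; apply: ler_wpM2r.
nra.
Qed.

(** * One-way distributions as reweightings by a function of [x] *)

Lemma log_ratio_le (R : realType) (p q v : R) : 0 <= p -> 0 <= q ->
  (log_ratio p q <= v%:E)%E = (p <= 2 `^ v * q).
Proof.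
have ln2 : 0 < ln 2 :> R by rewrite ln_gt0// ltr1n.
rewrite /log_ratio => p0 q0; case: eqP => [->|/eqP pn0].
  by rewrite leNye mulr_ge0// powR_ge0.
have p_gt0 : 0 < p by rewrite lt_def pn0.
case: eqP => [->|/eqP qn0].
  by rewrite mulr0 leye_eq leNgt p_gt0.
have q_gt0 : 0 < q by rewrite lt_def qn0.
by rewrite lee_fin /log2 ler_pdivrMr// -ln_powR ler_ln ?posrE
  ?divr_gt0 ?powR_gt0// ler_pdivrMr.
Qed.

Lemma le_margX (R : realType) (X Y : finType) (m : {ffun X * Y -> R}) x y :
  (forall a, 0 <= m a) -> m (x, y) <= margX m x.
Proof. by move=> m0; rewrite /margX (bigD1 y)//= lerDl sumr_ge0. Qed.

Lemma le_margY (R : realType) (X Y : finType) (m : {ffun X * Y -> R}) x y :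
  (forall a, 0 <= m a) -> m (x, y) <= margY m y.
Proof. by move=> m0; rewrite /margY (bigD1 x)//= lerDl sumr_ge0. Qed.

(** Where [l] is positive, the formula is equality of the conditionals. Elsewhere the right side can
    only be too large; but over [y] both sides sum to [margX l x], so every excess vanishes. *)
Lemma one_way_scale (R : realType) (X Y : finType) (l m : {ffun X * Y -> R}) x y :
  (forall a, 0 <= l a) -> (forall a, 0 <= m a) -> one_way l m ->
  l (x, y) = margX l x / margX m x * m (x, y).
Proof.
move=> l0 m0 ow.
have L0 : 0 <= margX l x by apply: sumr_ge0.
have M0 : 0 <= margX m x by apply: sumr_ge0.
have scale y' : 0 < l (x, y') ->
    0 < margX m x /\ l (x, y') = margX l x / margX m x * m (x, y').
  move=> l_gt0; have := ow x y' l_gt0; rewrite /cond_YX => cond_eq.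
  have L_gt0 : 0 < margX l x := lt_le_trans l_gt0 (le_margX _ _ l0).
  have M_gt0 : 0 < margX m x.
    rewrite lt_def M0 andbT; apply/eqP => Meq0.
    move: cond_eq; rewrite Meq0 invr0 mulr0 => /esym/eqP.
    by rewrite mulf_eq0 invr_eq0 !gt_eqF.
  by split=> //; rewrite mulrAC -mulrA cond_eq mulrC divfK ?gt_eqF.
have [Leq0|Ln0] := eqVneq (margX l x) 0.
  rewrite Leq0 !mul0r; apply/eqP; rewrite eq_le l0 andbT -Leq0.
  exact: le_margX.
have [M_gt0|] := ltP 0 (margX m x); last first.
  move=> Mle; case/negP: Ln0; rewrite /margX big1// => y' _.
  apply/eqP; rewrite eq_le l0 andbT leNgt; apply/negP => /scale[].
  by rewrite ltNge Mle.
have le_l y' : 0 <= margX l x / margX m x * m (x, y') - l (x, y').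
  have := l0 (x, y'); rewrite le_eqVlt => /predU1P[<-|/scale[_ e]].
    by rewrite subr0 mulr_ge0// divr_ge0.
  by rewrite -e subrr.
have : \sum_y' (margX l x / margX m x * m (x, y') - l (x, y')) == 0.
  by rewrite sumrB -mulr_sumr divfK ?subrr ?(gt_eqF M_gt0).
rewrite psumr_eq0 => [/allP/(_ y (mem_index_enum _))/=|//].
by rewrite subr_eq0 => /eqP.
Qed.

(** Here [r] is the density of a one-way distribution relative to [m]. The last event says that the
    ratio of the conditionals of [x] given [y] exceeds [K], with denominators cleared: that ratio is
    [r x * margY m y] over the new mass of [y]. The event is invariant under rescaling [r]. *)
Definition has_scaling (R : realType) (X Y Z : finType) (f : {set X * Y * Z})
    (K eps delta : R) (m : {ffun X * Y -> R}) : Prop :=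
  exists (r : X -> R) (g : Y -> Z),
    [/\ forall x, 0 <= r x,
        \sum_a r a.1 * m a = 1,
        \sum_(a | (a.1, a.2, g a.2) \notin f) r a.1 * m a <= eps &
        \sum_(a | K * \sum_x r x * m (x, a.2) < r a.1 * margY m a.2)
          r a.1 * m a <= delta].

Lemma feasible_scaling (R : realType) (X Y Z : finType) (f : {set X * Y * Z})
    (l m : {ffun X * Y -> R}) (eps delta v : R) :
  is_dist m -> feasible f m eps l -> eps < 1 ->
  Pr l (fun a => (v%:E < log_ratio (cond_XY l a.1 a.2) (cond_XY m a.1 a.2))%E)
    <= delta ->
  has_scaling f (2 `^ v) eps delta m.
Proof.
move=> [m0 m1] [[l0 l1] ow errl] eps1 crl.
pose r x := margX l x / margX m x.
have lE x y : l (x, y) = r x * m (x, y) by exact: one_way_scale.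
have r0 x : 0 <= r x by rewrite divr_ge0 ?sumr_ge0.
(* Since [eps < 1], the default value 1 of the minimum cannot be what meets the bound, so an actual
   [g] does. *)
have [|[g _ gP]] := bigmin_leP _ _ _ _ errl; first by rewrite leNgt eps1.
exists r, g; split=> //.
- by rewrite -l1; apply: eq_bigr => -[x y] _; rewrite lE.
- by apply: le_trans gP; apply: ler_sum => -[x y] _; rewrite lE.
apply: le_trans crl; rewrite [leRHS]big_mkcond [leLHS]big_mkcond /=.
apply: ler_sum => -[x y] _ /=; rewrite -lE.
have [ratio_gt|_] := ifPn; last by case: ifP.
have := l0 (x, y); rewrite le_eqVlt => /predU1P[<-|l_gt0].
  by case: ifP.
rewrite ifT// ltNge log_ratio_le; last 2 first.
- by rewrite divr_ge0// sumr_ge0.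
- by rewrite divr_ge0// sumr_ge0.
have lY : 0 < margY l y := lt_le_trans l_gt0 (le_margY _ _ l0).
have mxy : 0 < m (x, y).
  rewrite lt_def m0 andbT; apply/eqP => m_eq0.
  by move: l_gt0; rewrite lE m_eq0 mulr0 ltxx.
have mY : 0 < margY m y := lt_le_trans mxy (le_margY _ _ m0).
have rY : \sum_x0 r x0 * m (x0, y) = margY l y.
  by apply: eq_bigr => x' _; rewrite lE.
rewrite rY in ratio_gt; rewrite -ltNge /cond_XY /= ltr_pdivlMr// lE.
have -> : 2 `^ v * (m (x, y) / margY m y) * margY l y =
    2 `^ v * margY l y * (m (x, y) / margY m y) by rewrite mulrAC.
have -> : r x * m (x, y) = r x * margY m y * (m (x, y) / margY m y).
  by rewrite -[RHS]mulrA [margY m y * _]mulrC divfK ?gt_eqF.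
by rewrite ltr_pM2r// divr_gt0.
Qed.

(** * Greedy decomposition of a distribution *)

(* The scale is chosen so that some x loses all its weight, hence finitely many
   peelings exhaust c. *)
Lemma peel (R : realType) (X Y Z : finType) (f : {set X * Y * Z})
    (K eps delta tau : R) (mu : {ffun X * Y -> R}) (c : X -> R) :
  (forall m, is_dist m -> has_scaling f K eps delta m) ->
  (forall a, 0 < mu a) -> (0 < #|Y|)%N ->
  (forall x, 0 <= c x <= 1) -> (exists x, c x != 0) ->
  exists (P : X -> R) (g : Y -> Z),
    [/\ forall x, 0 <= P x <= c x,
        exists2 x, c x != 0 & P x = c x &
        \sum_(a | ((a.1, a.2, g a.2) \notin f) ||
                  (K * (\sum_x P x * mu (x, a.2)) < P a.1 * (tau * margY mu a.2)))
           P a.1 * mu a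
        <= (eps + delta) * (\sum_a P a.1 * mu a) +
           \sum_(y | \sum_x c x * mu (x, y) < tau * margY mu y)
             \sum_x P x * mu (x, y)].
Proof.
move=> scalable mu0 Y0 c01 [x1 cx1].
have c0 x : 0 <= c x by have /andP[] := c01 x.
have c1 x : c x <= 1 by have /andP[] := c01 x.
pose W := \sum_a c a.1 * mu a.
have W0 : 0 < W.
  have /card_gt0P[y1 _] := Y0.
  rewrite /W (bigD1 (x1, y1))//= ltr_pwDl//.
    by rewrite mulr_gt0// lt_def cx1 c0.
  by apply: sumr_ge0 => a _; rewrite mulr_ge0// ltW.
have Wn0 : W != 0 by rewrite gt_eqF.
(* The scaling hypothesis is applied to the part of [mu] that is still left, normalised. *)
pose m : {ffun X * Y -> R} := [ffun a => c a.1 * mu a / W].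
have [|r [g [r0 r1 wrong ratio]]] := scalable m.
  split=> [a|]; first by rewrite ffunE divr_ge0 ?mulr_ge0// ltW.
  by under eq_bigr do rewrite ffunE; rewrite -mulr_suml divff.
have [x2 cx2 r_max] := @arg_maxP _ _ _ x1 (fun x => c x != 0) r cx1.
have rx2 : 0 < r x2.
  rewrite lt_def r0 andbT; apply/eqP => r_eq0.
  move: r1; rewrite big1 => [/esym/eqP|a _]; first by rewrite oner_eq0.
  rewrite ffunE; have [->|ca] := eqVneq (c a.1) 0; first by rewrite !mul0r mulr0.
  have := r_max _ ca; rewrite r_eq0 => /= ra0.
  by rewrite (_ : r a.1 = 0) ?mul0r//; apply/eqP; rewrite eq_le ra0 r0.
pose p := (r x2)^-1; have p0 : 0 < p by rewrite invr_gt0.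
pose P x := c x * r x * p.
have P0 x : 0 <= P x by rewrite !mulr_ge0// ltW.
have Pm a : P a.1 * mu a = p * W * (r a.1 * m a) by rewrite ffunE /P; field.
have PmD y : \sum_x P x * mu (x, y) = p * W * \sum_x r x * m (x, y).
  by rewrite mulr_sumr; apply: eq_bigr => x _; rewrite -(Pm (x, y)).
have cS y : \sum_x c x * mu (x, y) = W * margY m y.
  rewrite mulr_sumr; apply: eq_bigr => x _; rewrite ffunE /=.
  by rewrite [RHS]mulrC divfK.
have pW0 : 0 < p * W by rewrite mulr_gt0.
exists P, g; split.
- move=> x; rewrite P0 /P.
  have [->|cx] := eqVneq (c x) 0; first by rewrite !mul0r lexx.
  by rewrite -mulrA ler_piMr// ler_pdivrMr// mul1r; exact: r_max.
- by exists x2 => //; rewrite /P /p mulfK ?gt_eqF.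
have -> : \sum_a P a.1 * mu a = p * W.
  by under eq_bigr do rewrite Pm; rewrite -mulr_sumr r1 mulr1.
(* A bad point has a wrong answer, a bad ratio for [m], or a depleted [y]. Indeed, if [y] is not
   depleted, [tau * margY mu y] is at most [W * margY m y], and [c <= 1] gives [P x <= r x * p]; so
   a bad ratio for [P] is one for [r]. *)
apply: (@le_trans _ _ (\sum_a (
   (if (a.1, a.2, g a.2) \notin f then P a.1 * mu a else 0) +
   (if K * \sum_x r x * m (x, a.2) < r a.1 * margY m a.2 then P a.1 * mu a else 0) +
   (if \sum_x c x * mu (x, a.2) < tau * margY mu a.2 then P a.1 * mu a else 0)))).
  rewrite [leLHS]big_mkcond /=; apply: ler_sum => -[x y] _ /=.
  have Pmu0 : 0 <= P x * mu (x, y) by rewrite mulr_ge0// ltW.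
  have if0 (b : bool) : 0 <= if b then P x * mu (x, y) else 0 by case: b.
  case: (boolP (_ \notin f)) => /= _; first by rewrite -addrA lerDl addr_ge0.
  rewrite add0r; case: ifPn => [bad|_]; last by rewrite addr_ge0.
  have [S_lt|S_ge] := ltP (\sum_x0 c x0 * mu (x0, y)) (tau * margY mu y).
    by rewrite lerDr.
  rewrite ifT ?addr0//.
  rewrite -(ltr_pM2l pW0) mulrCA -PmD.
  apply: lt_le_trans bad _; apply: le_trans (_ : P x * (W * margY m y) <= _).
    by rewrite -cS; exact: ler_wpM2l.
  have mY0 : 0 <= margY m y.
    by apply: sumr_ge0 => x' _; rewrite ffunE divr_ge0 ?mulr_ge0// ltW.
  rewrite [leRHS](_ : _ = r x * p * (W * margY m y)); last by ring.
  apply: ler_wpM2r; first by rewrite mulr_ge0// ltW.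
  by rewrite /P -mulrA ler_piMl// mulr_ge0// ltW.
rewrite !big_split /= -!big_mkcond /=; apply: lerD; last first.
  rewrite [leRHS]big_mkcond [leLHS]big_mkcond /=.
  pose F x y := if \sum_x c x * mu (x, y) < tau * margY mu y
    then P x * mu (x, y) else 0.
  rewrite [leLHS](_ : _ = \sum_x \sum_y F x y); last first.
    by rewrite pair_bigA; apply: eq_bigr => -[].
  rewrite exchange_big /= /F.
  by apply: ler_sum => y _; case: ifP => // _; rewrite big1.
rewrite mulrC mulrDr; apply: lerD.
  by under eq_bigr do rewrite Pm; rewrite -mulr_sumr ler_pM2l.
by under eq_bigr do rewrite Pm; rewrite -mulr_sumr ler_pM2l.
Qed.

(* The minimum is a potential: it pays for the peelings made at y once less than
   a fraction tau of the mass of y is left. *)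
Lemma decomposition (R : realType) (X Y Z : finType) (f : {set X * Y * Z})
    (K eps delta tau : R) (mu : {ffun X * Y -> R}) (z : Z) (n : nat) (c : X -> R) :
  (forall m, is_dist m -> has_scaling f K eps delta m) ->
  (forall a, 0 < mu a) -> (0 < #|Y|)%N -> 0 <= tau ->
  (forall x, 0 <= c x <= 1) -> (#|[pred x | c x != 0%R]| <= n)%N ->
  exists (N : nat) (P : nat -> X -> R) (g : nat -> Y -> Z),
    [/\ forall i x, 0 <= P i x,
        forall x, \sum_(i < N) P i x = c x &
        \sum_(i < N)
          \sum_(a | ((a.1, a.2, g i a.2) \notin f) ||
                  (K * (\sum_x P i x * mu (x, a.2))
                    < P i a.1 * (tau * margY mu a.2)))
           P i a.1 * mu a
        <= (eps + delta) * (\sum_a c a.1 * mu a) +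
           \sum_y Num.min (\sum_x c x * mu (x, y)) (tau * margY mu y)].
Proof.
move=> scalable mu0 Y0 tau0; elim: n c => [|n IH] c c01 card_c.
  have c0 x : c x = 0.
    apply/eqP; move: card_c; rewrite leqn0 => /eqP/card0_eq/(_ x).
    by rewrite inE => /negbFE.
  exists 0%N, (fun _ _ => 0), (fun _ _ => z); split=> // [x|].
    by rewrite big_ord0 c0.
  rewrite big_ord0 big1 ?mulr0 ?add0r => [|a _]; last by rewrite c0 mul0r.
  apply: sumr_ge0 => y _; rewrite le_min big1 => [|x _]; last by rewrite c0 mul0r.
  by rewrite lexx mulr_ge0// sumr_ge0// => x _; rewrite ltW.
have [[x cx]|c0] := pselect (exists x, c x != 0); last first.
  apply: IH => //; rewrite leqNgt; apply/negP => /(leq_ltn_trans (leq0n _)).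
  by move=> /card_gt0P[x cx]; apply: c0; exists x.
have [P [g [Pc [x1 cx1 Px1] Pbad]]] :=
  @peel R X Y Z f K eps delta tau mu c scalable mu0 Y0 c01 (ex_intro _ x cx).
have P0 x' : 0 <= P x' by have /andP[] := Pc x'.
have leP x' : P x' <= c x' by have /andP[] := Pc x'.
pose c' x := c x - P x.
have [x'||N [P' [g' [P'0 P'c' P'bad]]]] := IH c'.
- have /andP[_ c_le1] := c01 x'; rewrite subr_ge0 leP /c' lerBlDr.
  by rewrite (le_trans c_le1)// lerDl P0.
- rewrite -ltnS; apply: leq_trans card_c; apply: proper_card; apply/properP.
  split; last by exists x1; rewrite inE // negbK /c' Px1 subrr.
  apply/fintype.subsetP => x'; rewrite !inE; apply: contraNneq => c_eq0.
  by rewrite /c' c_eq0 sub0r oppr_eq0 eq_le P0 andbT -c_eq0 leP.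
exists N.+1, (fun i => if i is i'.+1 then P' i' else P),
  (fun i => if i is i'.+1 then g' i' else g); split.
- by case.
- by move=> x'; rewrite big_ord_recl /= P'c' /c' addrC subrK.
rewrite big_ord_recl /=; apply: le_trans (lerD Pbad P'bad) _.
rewrite addrACA -mulrDr; apply: lerD.
  rewrite -big_split /= (eq_bigr (fun a => c a.1 * mu a))// => a _.
  by rewrite -mulrDl /c' addrC subrK.
rewrite [X in X + _]big_mkcond -big_split /=; apply: ler_sum => y _.
have D0 : 0 <= \sum_x P x * mu (x, y).
  by apply: sumr_ge0 => x' _; rewrite mulr_ge0// ltW.
have -> : \sum_x c' x * mu (x, y) =
    \sum_x c x * mu (x, y) - \sum_x P x * mu (x, y).
  by rewrite -sumrB; apply: eq_bigr => x' _; rewrite mulrBl.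
set S := \sum_x c x * _; set D := \sum_x P x * _ in D0 *; set t := tau * _.
(* If [S < t], the minimum is the remaining mass and falls by exactly the [D] that is charged;
   otherwise nothing is charged and the new minimum is at most [t]. *)
have [St|tS] := ltP S t; last first.
  by rewrite add0r ge_min lexx orbT.
rewrite min_l; first by rewrite addrC subrK.
by rewrite lerBlDr (le_trans (ltW St))// lerDl.
Qed.

(** * Protocols for a fixed input distribution *)

Lemma exists_expr_lt (R : realType) (q eta : R) :
  0 <= q < 1 -> 0 < eta -> exists T : nat, q ^+ T < eta.
Proof.
move=> /andP[]; rewrite le_eqVlt => /predU1P[<- _|q0 q1] eta0.
  by exists 1%N; rewrite expr1.
have lnq : ln q < 0 by rewrite ln_lt0// q0.
exists (Num.truncn (ln eta / ln q)).+1.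
rewrite -ltr_ln ?posrE ?exprn_gt0// lnXn// -mulr_natl -ltr_ndivrMr//.
exact: truncnS_gt.
Qed.

(** Error budget: [eps + delta] for wrong answers and bad ratios, [tau] for peelings at depleted
    [y], [K / tau / 2 ^+ k] for hash collisions. The strict slack below [d] pays for the event that
    no round is accepted. *)
Lemma distributional_protocol (R : realType) (X Y Z : finType)
    (f : {set X * Y * Z}) (K eps delta tau : R) (k : nat)
    (mu : {ffun X * Y -> R}) (d : R) (z : Z) :
  (forall m, is_dist m -> has_scaling f K eps delta m) ->
  is_dist mu -> (forall a, 0 < mu a) -> (0 < #|X|)%N -> (0 < #|Y|)%N ->
  0 <= K -> 0 < tau -> eps + delta + tau + K / tau / 2 ^+ k < d ->
  exists (msg : X -> k.-tuple bool) (out : k.-tuple bool -> Y -> Z),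
    Pr mu (fun a => (a.1, a.2, out (msg a.1) a.2) \notin f) <= d.
Proof.
move=> scalable dmu mu0 X0 Y0 K0 tau0 lt_d.
have mY y : 0 < margY mu y.
  have /card_gt0P[x _] := X0.
  by apply: lt_le_trans (mu0 (x, y)) (le_margY _ _ _) => a; exact: ltW.
have [|//|N [P [g [P0 P1 Pbad]]]] := @decomposition R X Y Z f K eps delta tau mu z
  #|X| (fun _ => 1) scalable mu0 Y0 (ltW tau0).
- by move=> _; rewrite ler01 lexx.
- exact: max_card.
have N0 : (0 < N)%N.
  have /card_gt0P[x _] := X0; case: (N) (P1 x) => //.
  by rewrite big_ord0 => /esym/eqP; rewrite oner_eq0.
pose D (i : 'I_N) y := \sum_x P i x * mu (x, y).
(* [D i y / margY mu y] is the conditional expectation of [P i] given [y], here inflated by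
   [K / tau]. Then [b i y < P i x] is exactly the ratio event of the decomposition. *)
pose b (i : 'I_N) y := K * D i y / (tau * margY mu y).
have sum_D y : \sum_i D i y = margY mu y.
  rewrite exchange_big /=; apply: eq_bigr => x _.
  by rewrite -mulr_suml P1 mul1r.
have b0 i y : 0 <= b i y.
  have D0 : 0 <= D i y by apply: sumr_ge0 => x _; rewrite mulr_ge0// ltW.
  by rewrite divr_ge0 ?(mulr_ge0 K0)// mulr_ge0 ?(ltW tau0) ?(ltW (mY _)).
have sum_b y : \sum_i b i y <= K / tau.
  rewrite -mulr_suml -mulr_sumr sum_D; rewrite le_eqVlt; apply/predU1P; left; field.
  by rewrite !gt_eqF.
(* Rounds are free: all of them share the one [k]-bit message, so [T] may be as large as needed. *)
have [T T_lt] : exists T, (1 - N%:R^-1) ^+ T < d - (eps + delta + tau + K / tau / 2 ^+ k).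
  apply: exists_expr_lt; last by rewrite subr_gt0.
  rewrite subr_ge0 invf_le1 ?ltr0n// ler1n N0 /=.
  by rewrite ltrBlDr ltrDl invr_gt0 ltr0n.
have cN : (0 < #|'I_N|)%N by rewrite card_ord.
have proto := @sampling_protocol R X Y Z _ f k T z (fun i : 'I_N => P i) b
  (fun i : 'I_N => g i) (K / tau) (fun i => P0 i) P1 b0 sum_b cN.
apply: (derandomize proto) => //; rewrite card_ord.
have split3 (A C : R) (B : X * Y -> R) :
    \sum_a mu a * (A + B a + C) = A + \sum_a mu a * B a + C.
  under eq_bigr do rewrite !mulrDr.
  by rewrite !big_split /= -!mulr_suml; case: dmu => _ ->; rewrite !mul1r.
rewrite (split3 _ _ (fun a => \sum_(i < N | _) P i a.1)).
have : \sum_a mu a * (\sum_(i < N | (b i a.2 < P i a.1)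
    || ((a.1, a.2, g i a.2) \notin f)) P i a.1) <= eps + delta + tau; last by lra.
(* The decomposition starts from [c = 1], where the potential is at most [tau] times the total
   mass. *)
apply: le_trans (_ : _ <= (eps + delta) * (\sum_a 1 * mu a) +
           \sum_y Num.min (\sum_x 1 * mu (x, y)) (tau * margY mu y)) _; last first.
  under eq_bigr do rewrite mul1r.
  case: (dmu) => _ ->; rewrite mulr1 lerD2l.
  apply: le_trans (_ : _ <= \sum_y tau * margY mu y) _.
    by apply: ler_sum => y _; rewrite ge_min lexx orbT.
  rewrite -mulr_sumr /margY exchange_big pair_bigA /=.
  rewrite (eq_bigr mu) => [|[]//].
  by case: (dmu) => _ ->; rewrite mulr1.
apply: le_trans Pbad; under eq_bigr do rewrite mulr_sumr big_mkcond.
rewrite exchange_big /=; rewrite le_eqVlt; apply/predU1P; left; apply: eq_bigr => i _.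
rewrite [RHS]big_mkcond; apply: eq_bigr => -[x y] _ /=.
rewrite orbC /b ltr_pdivrMr ?mulr_gt0// /D.
by case: ifP => // _; rewrite mulrC.
Qed.

(** * Logarithms, nonnegativity, and the upper bound on communication *)

Lemma ln2_gt0 (R : realType) : 0 < ln 2 :> R.
Proof. by rewrite ln_gt0// ltr1n. Qed.

Lemma log2_ge0 (R : realType) (x : R) : 1 <= x -> 0 <= log2 x.
Proof. by move=> x1; rewrite /log2 divr_ge0 ?ln_ge0 ?ler1n. Qed.

Lemma log2M (R : realType) (x y : R) : 0 < x -> 0 < y ->
  log2 (x * y) = log2 x + log2 y.
Proof. by move=> x0 y0; rewrite /log2 lnM ?posrE// mulrDl. Qed.

Lemma powR_log2 (R : realType) (x : R) : 0 < x -> 2 `^ log2 x = x.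
Proof.
move=> x0; apply: (@ln_inj _ _ _ (powR_gt0 _ _)) => //.
by rewrite ln_powR /log2 divfK ?gt_eqF ?ln2_gt0.
Qed.

Lemma log2_le (R : realType) (x v : R) : 0 < x -> x <= 2 `^ v -> log2 x <= v.
Proof.
move=> x0; rewrite -ler_ln ?posrE ?powR_gt0// ln_powR => le_v.
by rewrite ler_pdivrMr ?ln2_gt0.
Qed.

Lemma log_inv_ge1 (R : realType) (eps : R) : 1 <= log_inv eps.
Proof. by rewrite le_max lexx. Qed.

Lemma log2_le_log_inv (R : realType) (eps : R) : log2 (1 / eps) <= log_inv eps.
Proof. by rewrite le_max lexx orbT. Qed.

(** A reweighting by a function of [x] cannot move mass off the single atom. Point masses then
    witness that [crment] and [rment] are nonnegative. *)
Lemma one_way_point_mass (R : realType) (X Y : finType) (a0 : X * Y)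
    (m l : {ffun X * Y -> R}) :
  m = [ffun a => (a == a0)%:R] -> is_dist l -> one_way l m -> l = m.
Proof.
move=> mE [l0 l1] ow.
have m0 a : 0 <= m a by rewrite mE ffunE.
have l_out a : a != a0 -> l a = 0.
  case: a => x y an; rewrite (one_way_scale x y l0 m0 ow) mE ffunE.
  by rewrite (negbTE an) mulr0.
apply/ffunP => a; rewrite mE ffunE; have [->|an] := eqVneq a a0; last exact: l_out.
by rewrite -l1 (bigD1 a0)//= big1 ?addr0// => i /l_out.
Qed.

Lemma is_dist_point_mass (R : realType) (T : finType) (a0 : T) :
  is_dist [ffun a => (a == a0)%:R : R].
Proof.
split=> [a|]; first by rewrite ffunE.
rewrite (bigD1 a0)//= ffunE eqxx big1 ?addr0// => a /negbTE an.
by rewrite ffunE an.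
Qed.

Lemma crment_ge0 (R : realType) (X Y Z : finType) (f : {set X * Y * Z}) (eps delta : R) :
  (0 < #|X|)%N -> (0 < #|Y|)%N -> delta < 1 -> (0 <= crment f eps delta)%E.
Proof.
move=> /card_gt0P[x0 _] /card_gt0P[y0 _] delta1.
pose m : {ffun X * Y -> R} := [ffun a => (a == (x0, y0))%:R].
have dm : is_dist m by exact: is_dist_point_mass.
apply: le_ereal_sup_tmp; exists (crment_at f m eps delta); first by exists m.
apply/ereal_infP => _ [l [dl ow _] <-].
have -> : l = m by apply: one_way_point_mass ow.
apply/ereal_infP => _ [c /= Prc <-]; rewrite lee_fin leNgt; apply/negP => c0.
have : 1 <= delta; last by rewrite leNgt delta1.
have m1 : m (x0, y0) = 1 by rewrite ffunE eqxx.
apply: le_trans Prc; rewrite -m1 /Pr (bigD1 (x0, y0))/=.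
  by rewrite lerDl sumr_ge0// => a _; case: dm.
have mY : 0 < margY m y0.
  by apply: lt_le_trans (le_margY x0 _ (proj1 dm)); rewrite m1.
have cond0 : 0 < cond_XY m x0 y0 by rewrite /cond_XY m1 divr_gt0.
rewrite ltNge log_ratio_le ?(ltW cond0)// -ltNge gtr_pMl//.
by rewrite -ltr_ln ?posrE ?powR_gt0// ln1 ln_powR pmulr_llt0 ?ln2_gt0.
Qed.

Lemma rment_ge0 (R : realType) (X Y Z : finType) (f : {set X * Y * Z}) (eps : R) :
  (0 < #|X|)%N -> (0 < #|Y|)%N -> (0 <= rment f eps)%E.
Proof.
move=> /card_gt0P[x0 _] /card_gt0P[y0 _].
pose m : {ffun X * Y -> R} := [ffun a => (a == (x0, y0))%:R].
have dm : is_dist m by exact: is_dist_point_mass.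
apply: le_ereal_sup_tmp; exists (rment_at f m eps); first by exists m.
apply/ereal_infP => _ [l [dl ow _] <-].
have -> : l = m by apply: one_way_point_mass ow.
apply: le_trans (le_bigmax _ _ (x0, y0)).
by rewrite /log_ratio ffunE eqxx oner_eq0 divr1 /log2 ln1 mul0r.
Qed.

Lemma R1pub_ge0 (R : realType) (X Y Z : finType) (f : {set X * Y * Z}) (eps : R) :
  (0 <= R1pub f eps)%E.
Proof. by apply/ereal_infP => _ [c _ <-]; rewrite lee_fin. Qed.

(** The infima need not be attained; the strict bound by [v] yields a distribution and a constant
    below [v]. *)
Lemma has_scaling_of_crment (R : realType) (X Y Z : finType) (f : {set X * Y * Z})
    (eps delta v : R) (m : {ffun X * Y -> R}) :
  eps < 1 -> is_dist m -> (crment f eps delta < v%:E)%E ->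
  has_scaling f (2 `^ v) eps delta m.
Proof.
move=> eps1 dm crv.
have : (crment_at f m eps delta < v%:E)%E.
  by apply: le_lt_trans crv; apply: ereal_sup_ubound; exists m.
move=> /ereal_inf_ltP[_ [l fl <-] /ereal_inf_ltP[_ [c /= Prc <-] cv]].
apply: (feasible_scaling dm fl eps1); apply: le_trans Prc.
apply: le_Pr; first by case: fl.
by move=> a _; apply: lt_trans.
Qed.

Lemma R1pub_le_crment (R : realType) (X Y Z : finType) (f : {set X * Y * Z}) (eps : R) :
  (0 < #|X|)%N -> (0 < #|Y|)%N -> complete_rel f -> 0 < eps -> eps / 5 < 1 ->
  (R1pub f eps <= crment f (eps / 5)%R (eps / 5)%R + (16 * log_inv eps)%:E)%E.
Proof.
move=> X0 Y0 fc eps0 eps5.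
have [z _] : exists z : Z, true.
  have /card_gt0P[x _] := X0; have /card_gt0P[y _] := Y0.
  by have [z _] := fc x y; exists z.
have := crment_ge0 f (eps / 5) X0 Y0 eps5.
case crE: (crment f (eps / 5) (eps / 5)) => [c||] // c0; last by rewrite leey.
rewrite lee_fin in c0.
pose v := c + 1.
have scal m : is_dist m -> has_scaling f (2 `^ v) (eps / 5) (eps / 5) m.
  by move=> dm; apply: has_scaling_of_crment => //; rewrite crE lte_fin ltrDl.
have eps50 : 0 < 50 / eps by rewrite divr_gt0.
have log50 : 0 <= log2 (50 / eps).
  by apply: log2_ge0; rewrite ler_pdivlMr//; lra.
pose k := (Num.truncn (v + 2 * log2 (50 / eps))).+1.
have kgt : v + 2 * log2 (50 / eps) < k%:R by exact: truncnS_gt.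
have kle : k%:R <= v + 2 * log2 (50 / eps) + 1.
  by rewrite /k -natr1 lerD2r truncn_le /v; lra.
clearbody k.
have pow_k : 2 `^ v * (50 / eps) ^+ 2 <= 2 ^+ k.
  rewrite -[leRHS]powR_mulrn// -{1}(powR_log2 eps50) -powR_mulrn ?powR_ge0//.
  rewrite -powRrM -powRD ?pnatr_eq0 ?implybT//.
  by rewrite ler_powR ?ler1n// mulrC ltW.
have pub : has_pub_protocol f eps k.
  (* The distributional error is at most [2 * eps / 5 + 2 * eps / 50], which is 0.44 [eps]. The
     value 0.45 [eps] leaves room for strictness, and its double is still below [eps]. *)
  apply: (@pub_protocol_of_distributional _ _ _ _ _ _ (eps * (45 / 100))) => //.
  - by rewrite mulr_ge0 ?ltW//; lra.
  - by lra.
  move=> m dm m0.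
  apply: (@distributional_protocol _ _ _ _ f (2 `^ v) (eps / 5) (eps / 5) (eps / 50)) => //.
  - by rewrite divr_gt0.
  have : 2 `^ v / (eps / 50) / 2 ^+ k <= eps / 50; last by lra.
  rewrite ler_pdivrMr ?exprn_gt0// ler_pdivrMr ?divr_gt0//.
  have -> : 2 `^ v = (2 `^ v * (50 / eps) ^+ 2) * (eps / 50) ^+ 2.
    by field; rewrite gt_eqF.
  rewrite [leRHS](_ : _ = 2 ^+ k * (eps / 50) ^+ 2); last by ring.
  by apply: ler_wpM2r; rewrite // exprn_ge0// divr_ge0// ltW.
apply: (@le_trans _ _ k%:R%:E).
  by apply: ge_ereal_inf; exists k%:R%:E => //; exists k.
rewrite lee_fin; apply: le_trans kle _.
(* As [log2 50 <= 6], the overhead beyond [c] is at most [14 + 2 * log2 (1 / eps)], hence at most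
   [16 * log_inv eps]. *)
have L1 := log_inv_ge1 eps; have := log2_le_log_inv eps.
have : log2 (50 / eps) = log2 50 + log2 (1 / eps).
  by rewrite -log2M ?divr_gt0// mul1r.
have : log2 50 <= 6 :> R.
  by apply: log2_le => //; rewrite powR_mulrn//; lra.
by rewrite /v; lra.
Qed.

(** * Comparison of the two entropy measures *)

(** If [l <= 2]^ s * m[pointwise, the conditional ratio can exceed]2 [^ s / delta] only at a [y]
    with [margY l y < delta * margY m y]. Such [y] have total [l]-mass at most [delta]. *)
Lemma crment_dist_le (R : realType) (X Y : finType) (l m : {ffun X * Y -> R})
    (delta s : R) :
  is_dist l -> is_dist m -> 0 < delta -> (rel_min_entropy l m <= s%:E)%E ->
  (crment_dist m delta l <= (s + log2 (1 / delta))%:E)%E.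
Proof.
move=> dl dm delta0 /bigmax_leP[_ le_s].
have [l0 l1] := dl; have [m0 m1] := dm.
apply: ge_ereal_inf; exists (s + log2 (1 / delta))%:E => //.
exists (s + log2 (1 / delta)) => //=.
apply: (@le_trans _ _ (Pr l (fun a => margY l a.2 < delta * margY m a.2))).
  apply: le_Pr => // -[x y] l_gt0 /=.
  have lY : 0 < margY l y := lt_le_trans l_gt0 (le_margY _ _ l0).
  have l_le : l (x, y) <= 2 `^ s * m (x, y) by rewrite -log_ratio_le// le_s.
  have m_gt0 : 0 < m (x, y).
    by have := lt_le_trans l_gt0 l_le; rewrite pmulr_rgt0// powR_gt0.
  have mY : 0 < margY m y := lt_le_trans m_gt0 (le_margY _ _ m0).
  have lc : 0 <= cond_XY l x y by rewrite divr_ge0 ?ltW.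
  have mc : 0 <= cond_XY m x y by rewrite divr_ge0 ?ltW.
  rewrite ltNge log_ratio_le// -ltNge.
  rewrite powRD ?pnatr_eq0 ?implybT// powR_log2 ?divr_gt0// => lt1.
  have {lt1} : l (x, y) * (1 / delta / margY m y) < l (x, y) / margY l y.
    apply: le_lt_trans lt1; rewrite /cond_XY.
    rewrite [leRHS](_ : _ = 2 `^ s * m (x, y) * (1 / delta / margY m y)); last by ring.
    by apply: ler_wpM2r l_le; rewrite !divr_ge0 ?ltW.
  rewrite ltr_pM2l// -mulrA mul1r -invfM ltf_pV2 ?posrE ?mulr_gt0//.
rewrite /Pr big_mkcond /=.
rewrite [leLHS](_ : _ = \sum_y \sum_x
    if margY l y < delta * margY m y then l (x, y) else 0); last first.
  by rewrite exchange_big pair_bigA /=; apply: eq_bigr => -[].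
apply: (@le_trans _ _ (\sum_y delta * margY m y)).
  apply: ler_sum => y _; case: ltP => [/ltW//|_].
  by rewrite big1// mulr_ge0 ?(ltW delta0)// sumr_ge0.
rewrite -mulr_sumr /margY exchange_big pair_bigA /=.
by rewrite (eq_bigr m) => [|[]//]; rewrite m1 mulr1.
Qed.

Lemma crment_le_rment (R : realType) (X Y Z : finType) (f : {set X * Y * Z})
    (eps delta : R) : 0 < delta ->
  (crment f eps delta <= rment f eps + (log2 (1 / delta))%:E)%E.
Proof.
move=> delta0; apply/ereal_supP => _ [m dm <-].
apply: (@le_trans _ _ (rment_at f m eps + (log2 (1 / delta))%:E)%E); last first.
  by apply: leeD2r; apply: ereal_sup_ubound; exists m.
rewrite -leeBlDr//; apply/ereal_infP => _ [l fl <-]; rewrite leeBlDr//.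
apply: (@le_trans _ _ (crment_dist m delta l)).
  by apply: ereal_inf_lbound; exists l.
have [dl _ _] := fl.
have le_s := @crment_dist_le R X Y l m delta _ dl dm delta0.
case SE: (rel_min_entropy l m) => [s||]; last 2 first.
- by rewrite leey.
(* When the relative min-entropy is [-oo], the bound holds for every real [s], which forces
   [crment_dist] down to [-oo]. *)
- have le_v v : (crment_dist m delta l <= v%:E)%E.
    by rewrite -[v](subrK (log2 (1 / delta))); apply: le_s; rewrite SE leNye.
  case: crment_dist le_v => [r||] le_v //; last by have := le_v 0.
  by have := le_v (r - 1); rewrite lee_fin lerBrDr gerDl ler10.
by rewrite -EFinD; apply: le_s; rewrite SE.
Qed.

(** * The lower bound on communication *)

(** With [t] the required weight, the numbers [p i - t] sum to 1/2, so the [2 * eps * (p i - t)] sum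
    to [eps], which the [e i] do not exceed in total. Hence some [e i] is at most
    [2 * eps * (p i - t)], and [e i >= 0] forces [t <= p i]. *)
Lemma heavy_message (R : realType) (M : finType) (p e : M -> R) (eps : R) :
  (forall i, 0 <= p i) -> (forall i, 0 <= e i) -> \sum_i p i = 1 ->
  \sum_i e i <= eps -> 0 < eps ->
  exists i, (2 * #|M|%:R)^-1 <= p i /\ e i <= 2 * eps * p i.
Proof.
move=> p0 e0 p1 e_eps eps0; apply: contrapT => nM.
have M0 : (0 < #|M|)%N.
  case: (posnP #|M|) => // /card0_eq M0; move: p1 (@oner_neq0 R).
  by rewrite big_pred0 => [<-|i]; [rewrite eqxx|exact: M0].
pose t : R := (2 * #|M|%:R)^-1.
have t0 : 0 <= t by rewrite invr_ge0.
have lt_e i : 0 < e i - 2 * eps * (p i - t).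
  rewrite subr_gt0; have [tp|pt] := leP t (p i); last first.
    apply: lt_le_trans (e0 i); rewrite pmulr_rlt0 ?subr_lt0//.
    by rewrite mulr_gt0.
  rewrite ltNge; apply/negP => e_le; apply: nM; exists i; split=> //.
  by apply: le_trans e_le _; rewrite ler_pM2l ?mulr_gt0// gerBl.
have : 0 < \sum_i (e i - 2 * eps * (p i - t)).
  have /card_gt0P[i _] := M0.
  by rewrite (bigD1 i)//= ltr_pwDl// sumr_ge0// => j _; exact: ltW.
rewrite sumrB -mulr_sumr sumrB p1 sumr_const -[t *+ _]mulr_natr.
have -> : t * #|M|%:R = 1 / 2 by rewrite /t; field; rewrite pnatr_eq0 -lt0n.
by lra.
Qed.

Lemma rment_le_of_protocol (R : realType) (X Y Z : finType) (f : {set X * Y * Z})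
    (eps : R) (c : nat) :
  0 < eps -> has_pub_protocol f eps c ->
  (rment f (2 * eps) <= (c%:R + 1)%:E)%E.
Proof.
move=> eps0 proto; apply/ereal_supP => _ [m dm <-]; have [m0 m1] := dm.
have [|msg [out errm]] :=
  @derandomize R X Y Z f c (fun _ _ => eps) m eps proto dm.
  by rewrite -mulr_suml m1 mul1r.
pose H := c.-tuple bool.
pose wrong h (a : X * Y) := (a.1, a.2, out h a.2) \notin f.
pose p (h : H) := \sum_(a | msg a.1 == h) m a.
pose e (h : H) := \sum_(a | (msg a.1 == h) && wrong h a) m a.
have [||||//|h [p_ge e_le]] := @heavy_message R H p e eps.
- by move=> h; apply: sumr_ge0.
- by move=> h; apply: sumr_ge0.
- by rewrite -m1 [RHS](partition_big (fun a => msg a.1) xpredT).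
- apply: le_trans errm; rewrite le_eqVlt; apply/predU1P; left.
  rewrite /Pr [RHS](partition_big (fun a => msg a.1) xpredT)//=.
  apply: eq_bigr => h _; apply: eq_bigl => a; rewrite andbC /wrong.
  by case: eqP => [->|]; rewrite ?andbF.
have cardH : #|{: H}|%:R = 2 ^+ c :> R by rewrite card_tuple card_bool natrX.
rewrite cardH -exprS in p_ge.
have p_gt0 : 0 < p h by apply: lt_le_trans p_ge; rewrite invr_gt0 exprn_gt0.
(* The condition on the message involves [x] only, so the law of [y] given [x] is unchanged; the
   density is at most [(p h)^-1], hence at most [2 ^+ c.+1]. *)
pose l : {ffun X * Y -> R} := [ffun a => if msg a.1 == h then m a / p h else 0].
have dl : is_dist l.
  split=> [a|]; first by rewrite ffunE; case: ifP => // _; rewrite divr_ge0 ?(ltW p_gt0).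
  under eq_bigr do rewrite ffunE.
  by rewrite -big_mkcond -mulr_suml divff ?gt_eqF.
have ow : one_way l m.
  move=> x y; rewrite /cond_YX /margX ffunE /=.
  under [in RHS]eq_bigr do rewrite ffunE /=.
  case: eqP => [_ _|_]; last by rewrite ltxx.
  by rewrite -mulr_suml invfM invrK mulrACA mulVf ?mulr1 ?gt_eqF.
have err_l : err f l <= 2 * eps.
  apply: le_trans (bigmin_le _ (finfun (out h)) _) _.
  rewrite /Pr; under eq_bigl do rewrite ffunE.
  under eq_bigr do rewrite ffunE.
  rewrite -big_mkcondr -mulr_suml ler_pdivrMr//.
  by apply: le_trans e_le; rewrite le_eqVlt; apply/predU1P; left;
    apply: eq_bigl => a; rewrite andbC.
apply: ge_ereal_inf; exists (rel_min_entropy l m); first by exists l.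
apply/bigmax_leP; split=> [|a _]; first exact: leNye.
rewrite log_ratio_le ?(proj1 dl)// ffunE.
case: ifP => _; last by rewrite mulr_ge0// powR_ge0.
rewrite mulrC; apply: ler_wpM2r => //.
by rewrite natr1 powR_mulrn// -[leRHS]invrK lef_pV2 ?posrE ?invr_gt0 ?exprn_gt0.
Qed.

Lemma rment_le_R1pub (R : realType) (X Y Z : finType) (f : {set X * Y * Z}) (eps : R) :
  0 < eps -> (rment f (2 * eps)%R - 1%:E <= R1pub f eps)%E.
Proof.
move=> eps0; apply/ereal_infP => _ [c proto <-].
by rewrite leeBlDr// -EFinD; exact: rment_le_of_protocol.
Qed.

(** * Assembling the bounds *)

Lemma leeD_muleDr (R : realType) (x : \bar R) (A r L : R) :
  (0 <= x)%E -> 1 <= A -> r <= A * L -> (x + r%:E <= A%:E * (x + L%:E))%E.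
Proof.
case: x => [x||] //; last first.
  by move=> _ A1 _; rewrite !addye// gt0_muley ?leey// lte_fin (lt_le_trans _ A1).
rewrite !lee_fin => x0 A1 rL; rewrite mulrDr lerD//.
by rewrite ler_peMl.
Qed.

Lemma log2_invV5_le (R : realType) (eps : R) : 0 < eps ->
  log2 (1 / (eps / 5)) <= 4 * log_inv eps.
Proof.
move=> eps0; have L1 := log_inv_ge1 eps; have := log2_le_log_inv eps.
have -> : 1 / (eps / 5) = 5 * (1 / eps) by field; rewrite gt_eqF.
rewrite (@log2M _ 5) ?divr_gt0//.
have : log2 5 <= 3 :> R by apply: log2_le => //; rewrite powR_mulrn//; lra.
by lra.
Qed.

Theorem theorem4p3 (R : realType) :
  [/\ (* rment_{2 eps}(f) - 1 <= R_eps(f) *)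
      forall (X Y Z : finType) (f : {set X * Y * Z}) (eps : R),
        (0 < #|X|)%N -> (0 < #|Y|)%N -> complete_rel f -> 0 < eps ->
        (rment f (2 * eps)%R - 1%:E <= R1pub f eps)%E,
      (* R_eps(f) <= crment_{eps/5, eps/5}(f) + O(log (1/eps)) *)
      exists2 C : R, 0 < C &
        forall (X Y Z : finType) (f : {set X * Y * Z}) (eps : R),
          (0 < #|X|)%N -> (0 < #|Y|)%N -> complete_rel f ->
          0 < eps -> eps / 5 < 1 ->
          (R1pub f eps <=
             crment f (eps / 5)%R (eps / 5)%R + (C * log_inv eps)%:E)%E,
      bigTheta_err (fun (eps : R) X Y Z (f : {set X * Y * Z}) => R1pub f eps)
                   (fun (eps : R) X Y Z (f : {set X * Y * Z}) => rment f eps)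
    & bigTheta_err (fun (eps : R) X Y Z (f : {set X * Y * Z}) => R1pub f eps)
                   (fun (eps : R) X Y Z (f : {set X * Y * Z}) => crment f eps eps)].
Proof.
have R1pub_le_rment : bigO_err
    (fun (eps : R) X Y Z (f : {set X * Y * Z}) => R1pub f eps)
    (fun (eps : R) X Y Z (f : {set X * Y * Z}) => rment f eps).
  (* The 20 is 16 from the upper bound plus 4 from replacing [crment] by [rment] at error
     [eps / 5]. *)
  exists 5, 20; split=> // [|eps X Y Z f eps0 eps1 X0 Y0 fc]; first by lra.
  have L1 := log_inv_ge1 eps.
  apply: le_trans (R1pub_le_crment X0 Y0 fc eps0 _) _; first by lra.
  apply: le_trans (leeD2r _ (crment_le_rment _ _ _)) _; first by rewrite divr_gt0.
  rewrite -addeA -EFinD; apply: leeD_muleDr; first exact: rment_ge0.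
    by lra.
  by have := log2_invV5_le eps0; lra.
have rment_le_R1pub' (eps : R) (X Y Z : finType) (f : {set X * Y * Z}) : 0 < eps ->
    (rment f eps <= R1pub f (eps / 2) + 1%:E)%E.
  move=> eps0; rewrite -leeBlDr// -[X in rment f X](_ : 2 * (eps / 2) = eps).
    by apply: rment_le_R1pub; rewrite divr_gt0.
  by field.
split.
- by move=> X Y Z f eps _ _ _; exact: rment_le_R1pub.
- by exists 16 => // X Y Z f eps; exact: R1pub_le_crment.
- split=> //; exists 2, 1; split=> // [|eps X Y Z f eps0 eps1 X0 Y0 fc].
    by lra.
  have L1 := log_inv_ge1 eps.
  apply: le_trans (rment_le_R1pub' _ _ _ _ _ eps0) _.
  by apply: leeD_muleDr; [exact: R1pub_ge0| |lra].
split.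
- exists 5, 16; split=> // [|eps X Y Z f eps0 eps1 X0 Y0 fc]; first by lra.
  apply: le_trans (R1pub_le_crment X0 Y0 fc eps0 _) _; first by lra.
  by apply: leeD_muleDr; [apply: crment_ge0 => //; lra|lra|].
(* The overhead is [log2 (1 / eps)] from passing to [rment] plus 1 from the lower bound at error
   [eps / 2]. *)
exists 2, 2; split=> // [|eps X Y Z f eps0 eps1 X0 Y0 fc]; first by lra.
have L1 := log_inv_ge1 eps; have := log2_le_log_inv eps => L2.
apply: le_trans (crment_le_rment _ _ eps0) _.
apply: le_trans (leeD2r _ (rment_le_R1pub' _ _ _ _ _ eps0)) _.
rewrite -addeA -EFinD; apply: leeD_muleDr; [exact: R1pub_ge0|lra|lra].
Qed.
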